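(* Let $k$ be a field, $\prec$ a term order on $k[X]=k[x_1,\dots,x_n]$ and $J\subset k[X]$ a monomial ideal. Consider any one of the strata $\mathcal{S}t(J,\prec)$ (with $\prec$ reliable), $\mathcal{S}t_h(J,\prec)$ (with $\prec$ arbitrary), or $\mathcal{S}t(J/\tau,\prec)$ (with $\prec$ reliable and $\tau$ any list of sets of monomials), with its variables $C$, its ideal $\mathcal{A}\subset k[C]$ and the level grading $\Lambda$. Then: (i) $\Lambda$ is a positive grading, that is, $\Lambda(X^\alpha C^\gamma)\succ\Lambda(1)$ for every monomial $X^\alpha C^\gamma\neq 1$ in the variables $X,C$; (ii) the ideal $\mathcal{A}$ of the stratum is $\Lambda$-homogeneous.
   Context: Strata. A term order is \emph{reliable} if for every monomial $X^\alpha$ the set of monomials $X^\beta\prec X^\alpha$ is finite. For a monomial $X^\alpha$ put $\mathrm{tail}(X^\alpha)=\{X^\beta : X^\beta\prec X^\alpha\}$ and $\mathrm{htail}(X^\alpha)=\{X^\beta: X^\beta\prec X^\alpha,\ |\beta|=|\alpha|\}$. Let $X^{\alpha_1},\dots,X^{\alpha_s}$ be the minimal monomial generators of $J$ and let $\tau=[\tau_1,\dots,\tau_s]$ be a list of sets of monomials. For each $i$ let $T_i$ be: $\mathrm{tail}(X^{\alpha_i})\setminus J$ in the case of $\mathcal{S}t(J,\prec)$; $\mathrm{htail}(X^{\alpha_i})\setminus J$ in the case of the homogeneous stratum $\mathcal{S}t_h(J,\prec)$; $\mathrm{tail}(X^{\alpha_i})\setminus(J\cup\tau_i)$ in the case of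 $\mathcal{S}t(J/\tau,\prec)$. All $T_i$ are finite. Introduce a set $C$ of new variables $c_{i\beta}$, one for each $i$ and each $X^\beta\in T_i$, and set $F_i=X^{\alpha_i}+\sum_{X^\beta\in T_i}c_{i\beta}X^\beta\in k[X,C]$, with leading monomial $X^{\alpha_i}$ (regarded as a polynomial in $X$ with coefficients in $k[C]$). For $i<j$ let $H_{ij}$ be a complete reduction of the $S$-polynomial of $F_i,F_j$ with respect to $\{F_1,\dots,F_s\}$ (division in the variables $X$ with coefficients in $k[C]$, so that no monomial in $X$ appearing in $H_{ij}$ lies in $J$). The ideal $\mathcal{A}\subset k[C]$ is generated by all coefficients in $k[C]$ of the monomials in $X$ of all the $H_{ij}$, and the stratum is the closed subscheme of $\mathbb{A}^{|C|}$ defined by $\mathcal{A}$. Level grading. The term order $\prec$ induces a total order on the group $\mathbb{Z}^n$, also denoted $\prec$, compatible with addition and such that for $\alpha,\beta\in\mathbb{N}^n$, $\beta\prec\alpha$ if and only if $X^\beta\prec X^\alpha$. $\Lambda$ is the grading of $k[X,C]$ (and of $k[C]$) over $(\mathbb{Z}^n,+,\prec)$ determined by $\Lambda(X^\alpha)=\alpha$ and $\Lambda(c_{i\beta})=\alpha_i-\beta$, extended multiplicatively to all monomials. *)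

(* Defs.v *)
From Stdlib Require Export Relation_Operators.
From HB Require Export structures.
From mathcomp Require Export all_boot all_order all_algebra finmap.
From mathcomp Require Export mpoly.
From mathcomp Require Export boolp classical_sets cardinality.

Set Implicit Arguments.
Unset Strict Implicit.
Unset Printing Implicit Defensive.

Import Order.TTheory GRing.Theory Num.Theory.

Local Open Scope classical_set_scope.
Local Open Scope ring_scope.

(* Monomials X^a are identified with their exponents a : 'X_{1..n}, so that the
   product of monomials is the sum of 'X_{1..n}.  A term order is given by its
   strict part: prec b a means X^b < X^a. *)

Record term_order (n : nat) (prec : rel 'X_{1..n}) : Prop := TermOrder {
  to_irr : irreflexive prec;
  to_trans : transitive prec;
  to_total : forall a b, a != b -> prec a b || prec b a;
  to_min : forall a, a != 0%MM -> prec 0%MM a;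
  to_add : forall a b c, prec a b -> prec (a + c)%MM (b + c)%MM }.

Definition reliable (n : nat) (prec : rel 'X_{1..n}) : Prop :=
  forall a, finite_set [set b | prec b a].

Definition ideal_gen (R : comNzRingType) (S : set R) : set R :=
  [set p | exists (r : nat) (u g : 'I_r -> R),
     (forall l, S (g l)) /\ p = \sum_(l < r) u l * g l].

Definition monomial_ideal (k : fieldType) (n : nat) (J : set {mpoly k[n]}) :
  Prop :=
  exists M : set 'X_{1..n}, J = ideal_gen [set 'X_[m] | m in M].

Definition minimal_generators (k : fieldType) (n s : nat)
    (J : set {mpoly k[n]}) (alpha : 'I_s -> 'X_{1..n}) : Prop :=
  J = ideal_gen [set 'X_[alpha i] | i in setT] /\
  forall i, ~ ideal_gen [set 'X_[k, alpha j] | j in [set j | j != i]]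
                        'X_[k, alpha i].

Inductive stratum (n s : nat) : Type :=
| St
| St_h
| St_tau of s.-tuple (set 'X_{1..n}).

Definition stratum_order (n s : nat) (K : stratum n s)
    (prec : rel 'X_{1..n}) : Prop :=
  match K with
  | St => reliable prec
  | St_h => True
  | St_tau _ => reliable prec
  end.

Definition in_tail (k : fieldType) (n s : nat) (prec : rel 'X_{1..n})
    (J : set {mpoly k[n]}) (alpha : 'I_s -> 'X_{1..n}) (K : stratum n s)
    (i : 'I_s) : set 'X_{1..n} :=
  [set b | [/\ prec b (alpha i), ~ J 'X_[b] &
     match K with
     | St => True
     | St_h => mdeg b = mdeg (alpha i)
     | St_tau tau => ~ tnth tau i b
     end]].

(* fset_set is junk (empty) on infinite sets; mem_tails below shows that this
   never happens under stratum_order. *)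
Definition tails (k : fieldType) (n s : nat) (prec : rel 'X_{1..n})
    (J : set {mpoly k[n]}) (alpha : 'I_s -> 'X_{1..n}) (K : stratum n s)
    (i : 'I_s) : {fset 'X_{1..n}} :=
  fset_set (in_tail prec J alpha K i).

Lemma in_tail_finite (k : fieldType) (n s : nat) (prec : rel 'X_{1..n})
    (J : set {mpoly k[n]}) (alpha : 'I_s -> 'X_{1..n}) (K : stratum n s)
    (i : 'I_s) :
  stratum_order K prec -> finite_set (in_tail prec J alpha K i).
Proof.
case: K => [rel_prec|_|tau rel_prec].
- by apply: sub_finite_set (rel_prec (alpha i)) => b [].
- pose B := (mdeg (alpha i)).+1.
  apply: (@sub_finite_set _ _ [set bmnm x | x in [set: 'X_{1..n < B}]]).
    move=> b [_ _ /= eq_deg].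
    have ltbB : (mdeg b < B)%N by rewrite eq_deg.
    by exists (BMultinom ltbB).
  exact/finite_image/finite_finset.
- by apply: sub_finite_set (rel_prec (alpha i)) => b [].
Qed.

Lemma mem_tails (k : fieldType) (n s : nat) (prec : rel 'X_{1..n})
    (J : set {mpoly k[n]}) (alpha : 'I_s -> 'X_{1..n}) (K : stratum n s)
    (i : 'I_s) (b : 'X_{1..n}) :
  stratum_order K prec ->
  (b \in tails prec J alpha K i) <-> in_tail prec J alpha K i b.
Proof.
move=> hK; rewrite /tails in_fset_set; last exact: in_tail_finite.
by split=> [/set_mem|/mem_set].
Qed.

Section Stratum.
Variables (k : fieldType) (n s : nat).
Variables (alpha : 'I_s -> 'X_{1..n}) (T : 'I_s -> {fset 'X_{1..n}}).

(* The index (i, b), with b in T i, of the variable c_{i b}. *)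
Definition cidx : finType := {i : 'I_s & T i}.

Definition ncvar : nat := #|{: cidx}|.

Definition kC := {mpoly k[ncvar]}.
Definition kXC := {mpoly kC[n]}.

Definition cvar (v : cidx) : kC := 'X_(enum_rank v).

Definition Fpoly (i : 'I_s) : kXC :=
  'X_[alpha i] +
  \sum_(b : T i) cvar (Tagged (fun j => T j : Type) b) *: 'X_[val b].

(* The F_i are monic, hence the absence of leading coefficients; the
   subtractions of exponents are exact. *)
Definition spoly (i j : 'I_s) : kXC :=
  let m := mlcm (alpha i) (alpha j) in
  'X_[(m - alpha i)%MM] * Fpoly i - 'X_[(m - alpha j)%MM] * Fpoly j.

Definition red_step (p q : kXC) : Prop :=
  exists (i : 'I_s) (g : 'X_{1..n}),
    p@_(g + alpha i)%MM != 0 /\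
    q = p - p@_(g + alpha i)%MM *: ('X_[g] * Fpoly i).

Definition complete_reduction (J : set {mpoly k[n]}) (p q : kXC) : Prop :=
  clos_refl_trans kXC red_step p q /\ forall b, J 'X_[b] -> q@_b = 0.

Definition stratum_ideal (H : 'I_s -> 'I_s -> kXC) : set kC :=
  ideal_gen [set c | exists (i j : 'I_s) (b : 'X_{1..n}),
               (i < j)%N /\ c = (H i j)@_b].

Definition zexp (a : 'X_{1..n}) : 'rV[int]_n := \row_l (a l)%:Z.

(* Level of the monomial X^a C^g. *)
Definition level (a : 'X_{1..n}) (g : 'X_{1..ncvar}) : 'rV[int]_n :=
  zexp a + \sum_(v : cidx)
    (zexp (alpha (tag v)) - zexp (val (tagged v))) *+ g (enum_rank v).

End Stratum.

Arguments Fpoly k [n s] alpha T i.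
Arguments spoly k [n s] alpha T i j.
Arguments level [n s] alpha T a g.
Arguments kC k [n s] T.
Arguments kXC k [n s] T.

(* The order induced by prec on Z^n: u < v iff v - u is a difference a - b of
   exponents with X^b < X^a. *)
Definition zprec (n : nat) (prec : rel 'X_{1..n}) (u v : 'rV[int]_n) : Prop :=
  exists a b, v - u = zexp a - zexp b /\ prec b a.

Section Zprec.
Variables (n : nat) (prec : rel 'X_{1..n}).
Hypothesis prec_to : term_order prec.

Lemma zexpD (a b : 'X_{1..n}) : zexp (a + b)%MM = zexp a + zexp b.
Proof. by apply/rowP => l; rewrite !mxE mnmDE PoszD. Qed.

Lemma zexp_inj : injective (@zexp n).
Proof.
by move=> a b eq_ab; apply/mnmP => l; move/rowP/(_ l): eq_ab; rewrite !mxE => -[].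
Qed.

Lemma zprec_zexp (a b : 'X_{1..n}) : zprec prec (zexp b) (zexp a) <-> prec b a.
Proof.
split; last by move=> lt_ba; exists a, b.
move=> [a' [b' [eq_d lt']]].
have eqD : (a + b' = b + a')%MM.
  apply: zexp_inj; rewrite !zexpD; apply/eqP.
  by rewrite -subr_eq0 opprD addrACA eq_d -[zexp b' - _]opprB subrr.
have := to_add prec_to b lt'; rewrite addmC (addmC a') -eqD.
case: (eqVneq a b) => [->|neq_ab]; first by rewrite (to_irr prec_to).
move=> lt1; case/orP: (to_total prec_to neq_ab) => // lt_ab.
have := to_trans prec_to lt1 (to_add prec_to b' lt_ab).
by rewrite (to_irr prec_to).
Qed.

Lemma zprec_add (u v w : 'rV[int]_n) :
  zprec prec u v -> zprec prec (u + w) (v + w).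
Proof. by move=> [a [b [e lt_ba]]]; exists a, b; rewrite opprD addrACA subrr addr0. Qed.

Lemma zprec_irr (u : 'rV[int]_n) : ~ zprec prec u u.
Proof.
rewrite -[u]add0r => /(@zprec_add _ _ (- u)); rewrite add0r subrr.
have -> : 0 = zexp (0%MM : 'X_{1..n}) by apply/rowP => l; rewrite !mxE mnm0E.
by rewrite zprec_zexp (to_irr prec_to).
Qed.

Lemma zprec_trans (u v w : 'rV[int]_n) :
  zprec prec u v -> zprec prec v w -> zprec prec u w.
Proof.
move=> [a [b [e lt_ba]]] [a' [b' [e' lt_ba']]].
exists (a + a')%MM, (b + b')%MM; split.
  by rewrite !zexpD opprD addrACA -e -e' [RHS]addrC addrA subrK.
apply: to_trans prec_to _ _ _ (to_add prec_to b' lt_ba) _.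
by rewrite addmC [X in prec _ X]addmC; apply: to_add.
Qed.

Lemma zprec_total (u v : 'rV[int]_n) :
  u != v -> zprec prec u v \/ zprec prec v u.
Proof.
pose d := v - u.
pose a := [multinom if (0 <= d ord0 l)%R then absz (d ord0 l) else 0%N | l < n].
pose b := [multinom if (0 <= d ord0 l)%R then 0%N else absz (d ord0 l) | l < n].
have e : v - u = zexp a - zexp b.
  rewrite -/d; apply/matrixP => l0 l; rewrite (ord1 l0).
  rewrite [RHS]mxE [zexp a _ l]mxE [X in _ + X]mxE [zexp b _ l]mxE !mnmE.
  case: (lerP 0 (d ord0 l)) => h; first by rewrite subr0 gez0_abs.
  by rewrite sub0r ltz0_abs // opprK.
have [eq_ab|neq_ab] := eqVneq a b.
  by move: e; rewrite eq_ab subrr => /eqP; rewrite subr_eq0 eq_sym => ->.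
move=> _; case/orP: (to_total prec_to neq_ab) => h; [right|left].
  by exists b, a; rewrite -opprB e opprB.
by exists a, b.
Qed.

End Zprec.

Definition homogeneous_component (k : fieldType) (N n : nat)
    (deg : 'X_{1..N} -> 'rV[int]_n) (d : 'rV[int]_n) (f : {mpoly k[N]}) :
    {mpoly k[N]} :=
  \sum_(g <- msupp f | deg g == d) f@_g *: 'X_[g].

Definition homogeneous_ideal (k : fieldType) (N n : nat)
    (deg : 'X_{1..N} -> 'rV[int]_n) (I : set {mpoly k[N]}) : Prop :=
  forall f d, I f -> I (homogeneous_component deg d f).

(* Main.v *)
Require Import Defs.

Set Implicit Arguments.
Unset Strict Implicit.
Unset Printing Implicit Defensive.

Import GRing.Theory.
Local Open Scope classical_set_scope.
Local Open Scope ring_scope.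

(** The grading is positive because the level of a monomial is a sum of levels
    of variables, and these are all positive for the order on Z^n: nonzero
    exponents are positive since 1 is the least monomial of a term order, and
    [alpha i - b] is positive since [b] runs over monomials below [alpha i].

    For the homogeneity of the ideal, the level of the variable [c_(i b)] is
    chosen exactly so that [F_i] is homogeneous of level [alpha i] in the
    variables X and C together ([bihomogeneous_Fpoly]).  Hence an S-polynomial
    is homogeneous of the level of the least common multiple of its two leading
    monomials ([bihomogeneous_spoly]), and a reduction step, which subtracts the
    multiple of some [F_i] that cancels one term, keeps this level
    ([bihomogeneous_red_step]).  So every coefficient of [H i j] is homogeneous,
    and an ideal generated by homogeneous elements is homogeneous
    ([homogeneous_ideal_gen]). *)

(** * Homogeneous polynomials and homogeneous ideals *)

(** Only the nonzero coefficients are constrained, so that 0 is homogeneous of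
    every degree. *)
Definition homogeneous_of (R : nzRingType) (N : nat) (V : zmodType)
    (deg : 'X_{1..N} -> V) (d : V) (f : {mpoly R[N]}) : Prop :=
  forall g, f@_g != 0 -> deg g = d.

Section HomogeneousOf.
Variables (R : nzRingType) (N : nat) (V : zmodType).
Variable deg : 'X_{1..N} -> V.
Implicit Types f h : {mpoly R[N]}.

Lemma homogeneous_of0 d : homogeneous_of deg d (0 : {mpoly R[N]}).
Proof. by move=> g; rewrite mcoeff0 eqxx. Qed.

Lemma homogeneous_ofX g : homogeneous_of deg (deg g) ('X_[g] : {mpoly R[N]}).
Proof. by move=> g'; rewrite mcoeffX; case: (eqVneq g g') => [->|_ /eqP]. Qed.

Lemma homogeneous_ofD d f h :
  homogeneous_of deg d f -> homogeneous_of deg d h ->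
  homogeneous_of deg d (f + h).
Proof.
move=> hf hh g; rewrite mcoeffD.
by case: (eqVneq f@_g 0) => [->|/hf //]; rewrite add0r => /hh.
Qed.

Lemma homogeneous_ofN d f :
  homogeneous_of deg d f -> homogeneous_of deg d (- f).
Proof. by move=> hf g; rewrite mcoeffN oppr_eq0 => /hf. Qed.

Lemma homogeneous_of_sum d (I : Type) (r : seq I) (P : pred I)
    (F : I -> {mpoly R[N]}) :
  (forall i, P i -> homogeneous_of deg d (F i)) ->
  homogeneous_of deg d (\sum_(i <- r | P i) F i).
Proof.
by move=> hF; elim/big_ind: _ => //;
  [exact: homogeneous_of0 | exact: homogeneous_ofD].
Qed.

Hypothesis degD : {morph deg : a b / (a + b)%MM >-> a + b}.

Lemma homogeneous_ofM d e f h :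
  homogeneous_of deg d f -> homogeneous_of deg e h ->
  homogeneous_of deg (d + e) (f * h).
Proof.
move=> hf hh g; rewrite -mcoeff_msupp => /msuppM_le /allpairsP[[a b] /=].
by case; rewrite !mcoeff_msupp => /hf <- /hh <- ->; rewrite degD.
Qed.

End HomogeneousOf.

Section HomogeneousIdeal.
Variables (k : fieldType) (N n : nat) (deg : 'X_{1..N} -> 'rV[int]_n).
Hypothesis degD : {morph deg : a b / (a + b)%MM >-> a + b}.
Implicit Types f h : {mpoly k[N]}.

Lemma mcoeff_homogeneous_component d f g :
  (homogeneous_component deg d f)@_g = if deg g == d then f@_g else 0.
Proof.
rewrite /homogeneous_component raddf_sum /=.
under eq_bigr => m _ do rewrite mcoeffZ mcoeffX.
have [gf|gNf] := boolP (g \in msupp f); last first.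
  rewrite (memN_msupp_eq0 gNf) if_same big_seq_cond big1 // => m /andP[mf _].
  by case: eqVneq => [e|]; [rewrite -e mf in gNf | rewrite mulr0].
rewrite big_mkcond (bigD1_seq g) //= eqxx mulr1 big1 ?addr0 // => m ne.
by rewrite (negPf ne) mulr0 if_same.
Qed.

Lemma homogeneous_component_sum d (I : Type) (r : seq I) (F : I -> {mpoly k[N]}) :
  homogeneous_component deg d (\sum_(i <- r) F i) =
  \sum_(i <- r) homogeneous_component deg d (F i).
Proof.
apply/mpolyP => g; rewrite mcoeff_homogeneous_component !raddf_sum /=.
under [RHS]eq_bigr => i _ do rewrite mcoeff_homogeneous_component.
by case: ifP => // _; rewrite big1.
Qed.

Lemma homogeneous_componentM d e f h :
  homogeneous_of deg e h ->
  homogeneous_component deg d (f * h) =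
  homogeneous_component deg (d - e) f * h.
Proof.
move=> hh; apply/mpolyP => g; rewrite mcoeff_homogeneous_component !mcoeffM.
(* As [h] is homogeneous, the product of two coefficients vanishes unless the
   degree of [a] is that of [a + b] minus [e]. *)
have termE (a b : 'X_{1..N}) : g = (a + b)%MM ->
  (homogeneous_component deg (d - e) f)@_a * h@_b =
  if deg g == d then f@_a * h@_b else 0.
  move=> ->; rewrite mcoeff_homogeneous_component degD.
  have [->|/hh ->] := eqVneq h@_b 0; first by rewrite !mulr0 if_same.
  by rewrite eq_sym subr_eq eq_sym; case: ifP => //; rewrite mul0r.
under [RHS]eq_bigr => m /eqP gE do rewrite (termE _ _ gE).
by case: ifP => // _; rewrite big1.
Qed.

(** The component of degree [d] of a combination of the generators is again one,
    with each coefficient replaced by its component of degree [d] minus the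
    degree of its generator. *)
Lemma homogeneous_ideal_gen (S : set {mpoly k[N]}) :
  (forall h, S h -> exists e, homogeneous_of deg e h) ->
  homogeneous_ideal deg (ideal_gen S).
Proof.
move=> homS _ d [r [u [h [Sh ->]]]].
have [e he] := choice (fun l => homS _ (Sh l)).
exists r, (fun l => homogeneous_component deg (d - e l) (u l)), h; split=> //.
rewrite homogeneous_component_sum; apply: eq_bigr => l _.
exact: homogeneous_componentM.
Qed.

End HomogeneousIdeal.

(** * The level grading *)

Section Level.
Variables (n s : nat) (alpha : 'I_s -> 'X_{1..n}) (T : 'I_s -> {fset 'X_{1..n}}).

Lemma zexp0 : zexp (0%MM : 'X_{1..n}) = 0.
Proof. by apply/rowP => l; rewrite !mxE mnm0E. Qed.

Lemma levelD a a' g g' :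
  level alpha T (a + a')%MM (g + g')%MM = level alpha T a g + level alpha T a' g'.
Proof.
rewrite /level zexpD addrACA -big_split /=; congr (_ + _).
by apply: eq_bigr => v _; rewrite mnmDE mulrnDr.
Qed.

Lemma level00 : level alpha T 0%MM 0%MM = 0.
Proof. by rewrite /level zexp0 add0r big1 // => v _; rewrite mnm0E. Qed.

Lemma level_cvar (v : cidx T) :
  level alpha T 0%MM U_(enum_rank v)%MM = zexp (alpha (tag v)) - zexp (val (tagged v)).
Proof.
rewrite /level zexp0 add0r (bigD1 v) //= mnm1E eqxx mulr1n big1 ?addr0 // => w ne.
by rewrite mnm1E (inj_eq enum_rank_inj) eq_sym (negPf ne).
Qed.

Section Positive.
Variables (prec : rel 'X_{1..n}) (prec_to : term_order prec).

Let nonneg (u : 'rV[int]_n) := u = 0 \/ zprec prec 0 u.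

Lemma zprec0_addl u v : zprec prec 0 u -> nonneg v -> zprec prec 0 (u + v).
Proof.
move=> u0 [->|v0]; first by rewrite addr0.
by apply: (zprec_trans prec_to v0); rewrite -[X in zprec _ X]add0r; apply: zprec_add.
Qed.

Lemma zprec0_zexp a : a != 0%MM -> zprec prec 0 (zexp a).
Proof. by move=> a0; rewrite -zexp0 zprec_zexp //; apply: to_min. Qed.

Lemma nonnegD u v : nonneg u -> nonneg v -> nonneg (u + v).
Proof.
by move=> [->|u0] v0; [rewrite add0r | right; apply: zprec0_addl].
Qed.

Lemma zprec0_mulrn u m : zprec prec 0 u -> zprec prec 0 (u *+ m.+1).
Proof.
move=> u0; elim: m => [//|m IH]; rewrite mulrS.
by apply: zprec0_addl => //; right.
Qed.

Hypothesis T_below : forall i b, b \in T i -> prec b (alpha i).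

(** The sum defining the level has only nonnegative terms, and one of them is
    positive: that of X if [a <> 0], and otherwise that of a variable of C. *)
Lemma level_positive a g :
  (a, g) != (0%MM, 0%MM) -> zprec prec (level alpha T 0%MM 0%MM) (level alpha T a g).
Proof.
rewrite level00 /level => nz.
pose w (v : cidx T) := zexp (alpha (tag v)) - zexp (val (tagged v)).
have w_pos v : zprec prec 0 (w v).
  exists (alpha (tag v)), (val (tagged v)).
  by rewrite subr0; split=> //; exact/T_below/valP.
have w_nonneg v m : nonneg (w v *+ m).
  by case: m => [|m]; [left | right; apply: zprec0_mulrn].
have sum_nonneg (P : pred (cidx T)) : nonneg (\sum_(v | P v) w v *+ g (enum_rank v)).
  by elim/big_ind: _ => //; [left | exact: nonnegD].
have [a0|a_nz] := eqVneq a 0%MM; last first.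
  by apply: zprec0_addl; [exact: zprec0_zexp | exact: sum_nonneg].
have /eqP/mnmP g_nz : g != 0%MM by apply: contraNneq nz => ->; rewrite a0.
have [l gl] : exists l, g l != 0%N.
  apply: contrapT => all0; apply: g_nz => l; rewrite mnm0E.
  by apply/eqP; apply: contrapT => gl; apply: all0; exists l; apply/negP.
rewrite a0 zexp0 add0r (bigD1 (enum_val l)) //= enum_valK.
apply: zprec0_addl; last exact: sum_nonneg.
by case: (g l) gl => // m _; exact/zprec0_mulrn/w_pos.
Qed.

End Positive.

(** * Reductions preserve homogeneity in X and C *)

Variable k : fieldType.
Implicit Types p q : kXC k T.

(** Elements of k[X,C] are polynomials in X over k[C], so homogeneity of level
    [d] in X and C together is read off from the coefficients in k[C]: the
    coefficient of [X^b] must make up the difference between [d] and [b]. *)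
Definition bihomogeneous (d : 'rV[int]_n) p : Prop :=
  forall b, homogeneous_of (level alpha T 0%MM) (d - zexp b) p@_b.

Lemma level0D : {morph level alpha T 0%MM : g h / (g + h)%MM >-> g + h}.
Proof. by move=> g h; rewrite -levelD addm0. Qed.

Lemma bihomogeneousX a : bihomogeneous (zexp a) ('X_[a] : kXC k T).
Proof.
move=> b; rewrite mcoeffX; case: eqVneq => [->|_]; last exact: homogeneous_of0.
by rewrite subrr -level00 -mpolyX0; apply: homogeneous_ofX.
Qed.

Lemma bihomogeneousD d p q :
  bihomogeneous d p -> bihomogeneous d q -> bihomogeneous d (p + q).
Proof. by move=> hp hq b; rewrite mcoeffD; apply: homogeneous_ofD. Qed.

Lemma bihomogeneousB d p q :
  bihomogeneous d p -> bihomogeneous d q -> bihomogeneous d (p - q).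
Proof.
move=> hp hq b; rewrite mcoeffB.
by apply: homogeneous_ofD => //; apply: homogeneous_ofN.
Qed.

Lemma bihomogeneous_sum d (I : Type) (r : seq I) (P : pred I) (F : I -> kXC k T) :
  (forall i, P i -> bihomogeneous d (F i)) ->
  bihomogeneous d (\sum_(i <- r | P i) F i).
Proof.
by move=> hF b; rewrite raddf_sum; apply: homogeneous_of_sum => i /hF.
Qed.

Lemma bihomogeneousZ d e (c : kC k T) p :
  homogeneous_of (level alpha T 0%MM) d c -> bihomogeneous e p ->
  bihomogeneous (d + e) (c *: p).
Proof.
by move=> hc hp b; rewrite mcoeffZ -addrA; apply: homogeneous_ofM => //;
  exact: level0D.
Qed.

Lemma bihomogeneousM d e p q :
  bihomogeneous d p -> bihomogeneous e q -> bihomogeneous (d + e) (p * q).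
Proof.
move=> hp hq b; rewrite mcoeffM; apply: homogeneous_of_sum => m /eqP bE.
rewrite [in zexp b]bE zexpD opprD addrACA; apply: homogeneous_ofM => //; exact: level0D.
Qed.

(** The level of [c_(i b)] compensates the difference between [X^(alpha i)] and
    [X^b]. *)
Lemma bihomogeneous_Fpoly i : bihomogeneous (zexp (alpha i)) (Fpoly k alpha T i).
Proof.
apply: bihomogeneousD; first exact: bihomogeneousX.
apply: bihomogeneous_sum => b _.
rewrite -[zexp (alpha i)](subrK (zexp (val b))).
apply: bihomogeneousZ; last exact: bihomogeneousX.
rewrite -(level_cvar (Tagged (fun j => T j : Type) b)).
exact: homogeneous_ofX.
Qed.

Lemma bihomogeneous_spoly i j :
  bihomogeneous (zexp (mlcm (alpha i) (alpha j))) (spoly k alpha T i j).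
Proof.
have shifted a l (le_la : (alpha l <= a)%MM) :
    bihomogeneous (zexp a) ('X_[(a - alpha l)%MM] * Fpoly k alpha T l).
  rewrite -[in zexp a](submK le_la) zexpD.
  by apply: bihomogeneousM; [exact: bihomogeneousX | exact: bihomogeneous_Fpoly].
by apply: bihomogeneousB; apply: shifted; [exact: lem_mlcml | exact: lem_mlcmr].
Qed.

(** The subtracted multiple of [F_i] has the level of the term that it cancels,
    which is the level of [p]. *)
Lemma bihomogeneous_red_step d p q :
  red_step alpha p q -> bihomogeneous d p -> bihomogeneous d q.
Proof.
move=> [i [g [_ ->]]] hp; apply: bihomogeneousB => //.
rewrite -[d](subrK (zexp (g + alpha i)%MM)).
apply: bihomogeneousZ; first exact: hp.
rewrite zexpD.
by apply: bihomogeneousM; [exact: bihomogeneousX | exact: bihomogeneous_Fpoly].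
Qed.

Lemma bihomogeneous_reduction d p q :
  clos_refl_trans _ (@red_step k n s alpha T) p q ->
  bihomogeneous d p -> bihomogeneous d q.
Proof.
elim=> [p1 p2 st|//|p1 p2 p3 _ IH1 _ IH2 hp]; last exact/IH2/IH1.
exact: bihomogeneous_red_step.
Qed.

Lemma homogeneous_stratum_ideal (J : set {mpoly k[n]}) (H : 'I_s -> 'I_s -> kXC k T) :
  (forall i j : 'I_s, (i < j)%N ->
     complete_reduction alpha J (spoly k alpha T i j) (H i j)) ->
  homogeneous_ideal (level alpha T 0%MM) (stratum_ideal H).
Proof.
move=> H_red; apply: homogeneous_ideal_gen; first exact: level0D.
move=> _ [i [j [b [lt_ij ->]]]].
exists (zexp (mlcm (alpha i) (alpha j)) - zexp b).
have [red _] := H_red i j lt_ij.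
by apply: (bihomogeneous_reduction red); exact: bihomogeneous_spoly.
Qed.

End Level.

Theorem lemma3p2 (k : fieldType) (n : nat) (prec : rel 'X_{1..n})
    (prec_to : term_order prec)
    (J : set {mpoly k[n]}) (J_mon : monomial_ideal J)
    (s : nat) (alpha : 'I_s -> 'X_{1..n}) (alpha_min : minimal_generators J alpha)
    (K : stratum n s) (K_order : stratum_order K prec) :
  let T := tails prec J alpha K in
  forall (H : 'I_s -> 'I_s -> kXC k T)
    (H_red : forall i j : 'I_s, (i < j)%N ->
       complete_reduction alpha J (spoly k alpha T i j) (H i j)),
  (forall (a : 'X_{1..n}) (g : 'X_{1..ncvar T}),
     (a, g) != (0%MM, 0%MM) ->
     zprec prec (level alpha T 0%MM 0%MM) (level alpha T a g)) /\
  homogeneous_ideal (level alpha T 0%MM) (stratum_ideal H).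
Proof.
move=> T H H_red; split; last exact: homogeneous_stratum_ideal H_red.
move=> a g; apply: level_positive => // i b.
by rewrite /T mem_tails // => -[].
Qed.
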